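(* Let $m$ and $n$ be positive integers and let $b$ be a positive real number with $b\neq 1$. Then $$\sum_{k=0}^{m-1}(-1)^{k}k^{n}=\frac{\mathcal{G}_{n+1}(1,b)-(-1)^{m}\,\mathcal{G}_{n+1}(m;1,b,b)}{2(n+1)(\ln b)^{n}}.$$
   Context: For positive real numbers $a,b,c$ with $a\neq b$ and $x\in\mathbb{R}$, the Genocchi type numbers $\mathcal{G}_n(a,b)$ and the Genocchi type polynomials $\mathcal{G}_n(x;a,b,c)$ ($n\ge 0$) are defined by the generating functions $$\frac{2t}{b^{t}+a^{t}}=\sum_{n=0}^{\infty}\mathcal{G}_{n}(a,b)\frac{t^{n}}{n!},\qquad \frac{2t}{b^{t}+a^{t}}\,c^{xt}=\sum_{n=0}^{\infty}\mathcal{G}_{n}(x;a,b,c)\frac{t^{n}}{n!},\qquad |t|<\frac{\pi}{|\ln a-\ln b|}.$$ In particular $\mathcal{G}_n(1,b)$ is the case $a=1$, and $\mathcal{G}_n(m;1,b,b)$ is the case $a=1$, $c=b$, $x=m$. *)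

(* Defs.v *)
From Stdlib Require Import Reals Factorial ClassicalEpsilon.
From Coquelicot Require Import Coquelicot.
Open Scope R_scope.

Definition egf_on (r : R) (F : R -> R) (g : nat -> R) : Prop :=
  forall t : R, Rabs t < r ->
    is_pseries (fun n => g n / INR (fact n)) t (F t).

(** The sequence [g] determined by [F t = sum_n g_n t^n / n!] for [|t| < r].
    It is unique when [r > 0]; if no such sequence exists, the value is an
    unspecified one, so nothing can be derived about [egf_coef r F] without
    first proving that the expansion holds on the whole interval. *)
Definition egf_coef (r : R) (F : R -> R) : nat -> R :=
  epsilon (inhabits (fun _ : nat => 0)) (egf_on r F).

Definition genocchi_radius (a b : R) : R := PI / Rabs (ln a - ln b).

(** For a base [a > 0], [Rpower a t = exp (t * ln a)] is the real power [a^t]. *)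
Definition genocchi_num (a b : R) : nat -> R :=
  egf_coef (genocchi_radius a b)
    (fun t => 2 * t / (Rpower b t + Rpower a t)).

Definition genocchi_poly (x a b c : R) : nat -> R :=
  egf_coef (genocchi_radius a b)
    (fun t => 2 * t / (Rpower b t + Rpower a t) * Rpower c (x * t)).

(* Main.v *)
Require Import Defs.
From Stdlib Require Import Reals Lra Lia Factorial ClassicalEpsilon.
From Coquelicot Require Import Coquelicot.
Open Scope R_scope.

(** Write L = ln b. For |t| < PI / |L| the generating functions satisfy
<<
    2t/(b^t + 1) - (-1)^m (2t/(b^t + 1)) b^(m t)
      = 2t (1 - (-b^t)^m) / (1 + b^t)
      = 2t * sum_(k < m) (-1)^k exp (k L t)
>>
    by the finite geometric sum [alternating_geometric], and comparing the
    coefficients of t^(n+1) gives the formula ([is_pseries_coef_unique]).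

    The Genocchi sequences are chosen as some sequence satisfying the expansion
    on the whole interval |t| < PI / |L|, so the substance of the proof is that
    such an expansion exists. Multiplication by the entire function c^(x t)
    reduces this to 2t/(b^t + 1) = t (1 - tanh (L t / 2)), that is, to the
    convergence of the Taylor series of tanh on |x| < PI / 2
    ([logistic_series]).

    This is shown by real analysis alone. The Taylor coefficients of tan and
    tanh are defined by the recurrences that y' = 1 + y^2 and y' = 1 - y^2
    impose; those of tan are nonnegative and dominate those of tanh in absolute
    value ([riccati_dominated]). A partial sum S of the series of tan satisfies
    S' <= 1 + S^2 on the nonnegative axis, so atan S(x) <= x and S(x) <= tan x
    for 0 <= x < PI / 2 ([tan_partial_le]); this bounds the radius of
    convergence from below ([CV_radius_tanh]). The sum of the series with the
    tanh coefficients solves y' = 1 - y^2, y(0) = 0, and therefore is tanh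
    ([tanh_series]). *)

(** * Taylor coefficients of tan and tanh *)

Definition coef_one (n : nat) : R := if (n =? 0)%nat then 1 else 0.

Lemma sum_coef_one N : sum_f_R0 coef_one N = 1.
Proof.
induction N as [|N IH]; [reflexivity|]. rewrite tech5, IH. apply Rplus_0_r.
Qed.

Lemma is_pseries_one x : is_pseries coef_one x 1.
Proof.
apply is_pseries_R, is_series_Reals.
intros eps He. exists 0%nat. intros n _.
rewrite (sum_eq _ coef_one), sum_coef_one.
- now rewrite R_dist_eq.
- intros [|k] _; unfold coef_one; simpl; ring.
Qed.

(** The recurrence for the coefficient of index n + 1 involves all earlier ones,
    so each stage of the recursion carries the whole initial segment found so
    far, padded arbitrarily. *)
Fixpoint riccati_prefix (s : R) (n : nat) : nat -> R :=
  match n with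
  | O => fun _ => 0
  | S p => fun k =>
      if (k <=? p)%nat then riccati_prefix s p k
      else (coef_one p
            + s * PS_mult (riccati_prefix s p) (riccati_prefix s p) p)
           / INR (S p)
  end.

(** Taylor coefficients at 0 of the solution of y' = 1 + s y^2, y(0) = 0:
    the coefficients of tan for [s = 1], of tanh for [s = -1]. *)
Definition riccati (s : R) (n : nat) : R := riccati_prefix s n n.

Lemma riccati_prefixE s n k : (k <= n)%nat -> riccati_prefix s n k = riccati s k.
Proof.
induction n as [|n IH]; intros Hk.
- now replace k with 0%nat by lia.
- destruct (Nat.eq_dec k (S n)) as [->|Hne]; [reflexivity|].
  simpl. destruct (Nat.leb_spec k n); [auto|lia].
Qed.

Lemma riccati_0 s : riccati s 0 = 0.
Proof. reflexivity. Qed.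

(** The differential equation y' = 1 + s y^2, coefficient by coefficient. *)
Lemma riccati_S s n :
  INR (S n) * riccati s (S n) =
  coef_one n + s * PS_mult (riccati s) (riccati s) n.
Proof.
replace (PS_mult (riccati s) (riccati s) n) with
  (PS_mult (riccati_prefix s n) (riccati_prefix s n) n).
- unfold riccati at 1; cbn [riccati_prefix].
  destruct (Nat.leb_spec (S n) n); [lia|].
  field. apply not_0_INR; lia.
- unfold PS_mult; apply sum_eq; intros i Hi.
  rewrite !riccati_prefixE by lia. reflexivity.
Qed.

(** The recurrences for tan and tanh differ by a sign only, so the triangle
    inequality propagates the bound. *)
Lemma riccati_dominated n : Rabs (riccati (-1) n) <= riccati 1 n.
Proof.
induction n as [n IH] using (well_founded_induction Nat.lt_wf_0).
destruct n as [|n]; [rewrite !riccati_0, Rabs_R0; lra|].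
assert (Hn : 0 < INR (S n)) by (apply lt_0_INR; lia).
apply Rmult_le_reg_l with (1 := Hn).
rewrite <- (Rabs_pos_eq (INR (S n))) at 1 by lra.
rewrite <- Rabs_mult, !riccati_S.
assert (HP : Rabs (PS_mult (riccati (-1)) (riccati (-1)) n)
             <= PS_mult (riccati 1) (riccati 1) n).
{ unfold PS_mult. eapply Rle_trans; [apply Rsum_abs|].
  apply sum_Rle; intros i Hi. rewrite Rabs_mult.
  apply Rmult_le_compat; try apply Rabs_pos; apply IH; lia. }
apply Rabs_le_between in HP.
apply Rabs_le. unfold coef_one. destruct (n =? 0)%nat; lra.
Qed.

Lemma riccati_pos n : 0 <= riccati 1 n.
Proof. eapply Rle_trans; [apply Rabs_pos|apply riccati_dominated]. Qed.

Lemma riccati_term_pos x : 0 <= x -> forall n, 0 <= riccati 1 n * x ^ n.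
Proof.
intros Hx n. apply Rmult_le_pos; [apply riccati_pos|now apply pow_le].
Qed.

(** The Cauchy product over the triangle i + j <= N is part of the full
    product over the square i, j <= N, and the remaining terms are nonnegative. *)
Lemma sum_PS_mult_le (u v : nat -> R) N :
  (forall n, 0 <= u n) -> (forall n, 0 <= v n) ->
  sum_f_R0 (PS_mult u v) N <= sum_f_R0 u N * sum_f_R0 v N.
Proof.
intros Hu Hv. destruct N as [|N]; [simpl; unfold PS_mult; simpl; lra|].
rewrite cauchy_finite by lia.
match goal with |- _ <= ?A + ?B => assert (0 <= B) end.
{ apply cond_pos_sum; intros k; apply cond_pos_sum; intros l.
  now apply Rmult_le_pos. }
unfold PS_mult at 1. lra.
Qed.

Definition tan_partial (N : nat) (x : R) : R :=
  sum_f_R0 (fun k => riccati 1 k * x ^ k) N.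

Lemma tan_partial_0 N : tan_partial N 0 = 0.
Proof.
unfold tan_partial. apply sum_eq_R0.
intros [|k] _; [rewrite riccati_0|simpl]; ring.
Qed.

(** The partial sums of the series of tan are subsolutions of y' = 1 + y^2:
    truncating the series discards only nonnegative terms of y^2. *)
Lemma tan_partial_deriv N x : 0 <= x ->
  exists d, is_derive (tan_partial (S N)) x d /\ d <= 1 + (tan_partial (S N) x)².
Proof.
intros Hx.
eexists; split.
{ apply is_derive_Reals. apply derivable_pt_lim_fs; lia. }
simpl pred.
pose proof (riccati_term_pos x Hx) as Hterm.
set (u := fun n => riccati 1 n * x ^ n).
rewrite (sum_eq _ (fun k => coef_one k + PS_mult u u k)).
2:{ intros n _. rewrite riccati_S, Rmult_1_l, Rmult_plus_distr_r. f_equal.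
    - destruct n; unfold coef_one; simpl; ring.
    - unfold PS_mult. rewrite Rmult_comm, scal_sum. apply sum_eq; intros i Hi.
      unfold u. replace n with (i + (n - i))%nat at 2 by lia.
      rewrite pow_add. ring. }
rewrite sum_plus, sum_coef_one.
apply Rplus_le_compat_l.
eapply Rle_trans; [apply sum_PS_mult_le; exact Hterm|].
unfold tan_partial; fold u.
assert (0 <= sum_f_R0 u N) by (apply cond_pos_sum; exact Hterm).
assert (0 <= u (S N)) by apply Hterm.
apply Rmult_le_compat; simpl; lra.
Qed.

(** Comparison with the exact solution: atan linearizes y' <= 1 + y^2 into
    (atan y)' <= 1, whence atan y <= x by the mean value theorem. *)
Lemma tan_partial_le N x : 0 <= x < PI / 2 -> tan_partial (S N) x <= tan x.
Proof.
intros [Hx0 Hx1].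
destruct Hx0 as [Hx0|<-].
2:{ rewrite tan_0, tan_partial_0. lra. }
assert (Hd : forall y, 0 <= y ->
  exists d, is_derive (fun y => atan (tan_partial (S N) y)) y d /\ d <= 1).
{ intros y Hy. destruct (tan_partial_deriv N y Hy) as [d [Hd Hle]].
  eexists; split.
  - apply (is_derive_comp atan); [apply is_derive_atan|exact Hd].
  - unfold scal; simpl; unfold mult; simpl.
    assert (0 < 1 + (tan_partial (S N) y)²).
    { generalize (Rle_0_sqr (tan_partial (S N) y)); lra. }
    apply (Rmult_le_reg_r (1 + (tan_partial (S N) y)²)); [lra|].
    rewrite Rmult_assoc, Rinv_l by lra. lra. }
assert (Hat : atan (tan_partial (S N) x) <= x).
{ destruct (MVT_gen (fun y => atan (tan_partial (S N) y)) 0 x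
             (Derive (fun y => atan (tan_partial (S N) y)))) as [c [Hc Heq]].
  - intros y Hy. rewrite Rmin_left, Rmax_right in Hy by lra.
    destruct (Hd y) as [d [Hd1 _]]; [lra|].
    apply Derive_correct. now exists d.
  - intros y Hy. rewrite Rmin_left, Rmax_right in Hy by lra.
    destruct (Hd y) as [d [Hd1 _]]; [lra|].
    apply derivable_continuous_pt. exists d. now apply is_derive_Reals.
  - rewrite Rmin_left, Rmax_right in Hc by lra.
    destruct (Hd c) as [d [Hd1 Hd2]]; [lra|].
    assert (HDc : Derive (fun y => atan (tan_partial (S N) y)) c = d)
      by now apply is_derive_unique.
    rewrite HDc, tan_partial_0, atan_0 in Heq.
    assert (d * (x - 0) <= 1 * (x - 0)) by (apply Rmult_le_compat_r; lra).
    lra. }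
rewrite <- (tan_atan (tan_partial (S N) x)).
destruct Hat as [Hat| ->]; [|lra].
left. apply tan_increasing; try lra.
apply atan_bound.
Qed.

(** With nonnegative coefficients, the bound of the partial sums by [tan r]
    bounds each term of the series of tan at [r], hence each term of the
    dominated series of tanh, for every [r < PI / 2]. *)
Lemma CV_radius_tanh x :
  Rabs x < PI / 2 -> Rbar_lt (Rabs x) (CV_radius (riccati (-1))).
Proof.
intros Hx. pose proof (Rabs_pos x) as H0.
set (r := (Rabs x + PI / 2) / 2).
apply Rbar_lt_le_trans with r; [simpl; unfold r; lra|].
apply (proj1 (CV_radius_bounded _)).
exists (tan r). intros n.
assert (Hr : 0 <= r < PI / 2) by (unfold r; lra).
eapply Rle_trans; [|apply (tan_partial_le n); exact Hr].
pose proof (riccati_term_pos r (proj1 Hr)) as Hterm.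
rewrite Rabs_mult, (Rabs_pos_eq (r ^ n)) by now apply pow_le.
apply Rle_trans with (riccati 1 n * r ^ n).
{ apply Rmult_le_compat_r; [now apply pow_le|apply riccati_dominated]. }
unfold tan_partial. simpl sum_f_R0.
assert (riccati 1 n * r ^ n <= sum_f_R0 (fun k => riccati 1 k * r ^ k) n).
{ destruct n; simpl; [lra|].
  generalize (cond_pos_sum _ n Hterm); simpl; lra. }
generalize (Hterm (S n)); simpl; lra.
Qed.

Lemma tanh_series_deriv x : Rabs x < PI / 2 ->
  is_derive (PSeries (riccati (-1))) x (1 - (PSeries (riccati (-1)) x)²).
Proof.
intros Hx. pose proof (CV_radius_tanh x Hx) as Hr.
replace (1 - _) with (PSeries (PS_derive (riccati (-1))) x);
  [now apply is_derive_PSeries|].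
apply is_pseries_unique.
apply is_pseries_ext with
  (PS_plus coef_one
           (PS_opp (PS_mult (riccati (-1)) (riccati (-1))))).
{ intros n. unfold PS_plus, PS_opp, PS_derive. rewrite riccati_S.
  unfold plus, opp; simpl. ring. }
apply (is_pseries_plus _ _ x 1 (- (PSeries (riccati (-1)) x)²)).
- apply is_pseries_one.
- apply (is_pseries_opp (PS_mult (riccati (-1)) (riccati (-1))) x
          ((PSeries (riccati (-1)) x)²)).
  apply is_pseries_mult; trivial;
    apply PSeries_correct, CV_radius_inside, Hr.
Qed.

(** Uniqueness for the Riccati equation y' = 1 - y^2 in the form of a conserved
    quantity: if Y is a primitive of y, then (y cosh - sinh) exp Y has
    derivative 0 and vanishes at 0. The exponential is the integrating factor of
    the linear equation w' = - y w satisfied by w = y cosh - sinh. *)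
Lemma tanh_series x : Rabs x < PI / 2 ->
  PSeries (riccati (-1)) x * cosh x = sinh x.
Proof.
intros Hx.
set (y := PSeries (riccati (-1))).
set (Y := PSeries (PS_Int (riccati (-1)))).
set (D := fun x => (y x * cosh x - sinh x) * exp (Y x)).
assert (HD : forall z, Rabs z < PI / 2 -> is_derive D z 0).
{ intros z Hz.
  assert (Hy : is_derive y z (1 - (y z)²)) by now apply tanh_series_deriv.
  assert (HY : is_derive Y z (y z)).
  { unfold y. rewrite (PSeries_ext _ (PS_derive (PS_Int (riccati (-1))))).
    - apply is_derive_PSeries. rewrite CV_radius_Int. now apply CV_radius_tanh.
    - intros n. unfold PS_derive, PS_Int. field. apply not_0_INR; lia. }
  assert (Hc : is_derive cosh z (sinh z))
    by apply is_derive_Reals, derivable_pt_lim_cosh.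
  assert (Hs : is_derive sinh z (cosh z))
    by apply is_derive_Reals, derivable_pt_lim_sinh.
  unfold D. auto_derive.
  - repeat split; trivial; eexists; eassumption.
  - replace (Derive (fun x => y x) z) with (1 - (y z)²)
      by (symmetry; now apply is_derive_unique).
    replace (Derive (fun x => Y x) z) with (y z)
      by (symmetry; now apply is_derive_unique).
    replace (Derive (fun x => cosh x) z) with (sinh z)
      by (symmetry; now apply is_derive_unique).
    replace (Derive (fun x => sinh x) z) with (cosh z)
      by (symmetry; now apply is_derive_unique).
    unfold Rsqr. ring. }
assert (H0 : D 0 = 0).
{ unfold D, y. rewrite PSeries_0, riccati_0, sinh_0. ring. }
assert (HDx : D x = 0).
{ apply Rabs_def2 in Hx.
  destruct (Rtotal_order x 0) as [Hlt|[->|Hgt]]; [|exact H0|].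
  - rewrite <- H0. apply eq_is_derive; [|exact Hlt].
    intros t Ht. apply HD, Rabs_def1; lra.
  - rewrite <- H0. symmetry. apply eq_is_derive; [|exact Hgt].
    intros t Ht. apply HD, Rabs_def1; lra. }
apply Rmult_integral in HDx as [HDx|HDx]; [lra|].
generalize (exp_pos (Y x)); lra.
Qed.

(** * Expansions of the generating functions *)

(** The identity 2 / (exp u + 1) = 1 - tanh (u / 2) turns the radius PI / 2 of
    tanh into PI / |L|. *)
Lemma logistic_series L : L <> 0 ->
  exists a, forall t, Rabs t < PI / Rabs L ->
    is_pseries a t (2 / (exp (L * t) + 1)).
Proof.
intros HL.
exists (PS_plus coef_one (PS_opp (fun n => riccati (-1) n * (L / 2) ^ n))).
intros t Ht.
set (x := L / 2 * t).
assert (Hx : Rabs x < PI / 2).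
{ assert (HL' : 0 < Rabs L) by now apply Rabs_pos_lt.
  unfold x, Rdiv. rewrite !Rabs_mult, (Rabs_pos_eq (/ 2)) by lra.
  apply (Rmult_lt_compat_l _ _ _ HL') in Ht.
  replace (Rabs L * (PI / Rabs L)) with PI in Ht by (field; lra). lra. }
replace (2 / (exp (L * t) + 1)) with (1 + - PSeries (riccati (-1)) x).
- apply (is_pseries_plus coef_one _ t 1 (- _)); [apply is_pseries_one|].
  apply (is_pseries_opp (fun n => riccati (-1) n * (L / 2) ^ n) t
          (PSeries (riccati (-1)) x)).
  apply is_pseries_R.
  apply is_series_ext with (fun n => riccati (-1) n * x ^ n).
  { intros n. unfold x. rewrite Rpow_mult_distr. symmetry. apply Rmult_assoc. }
  apply is_pseries_R, PSeries_correct, CV_radius_inside, CV_radius_tanh, Hx.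
- pose proof (tanh_series x Hx) as H.
  replace (L * t) with (x + x) by (unfold x; field).
  rewrite exp_plus. unfold cosh, sinh in H. rewrite exp_Ropp in H.
  pose proof (exp_pos x) as He.
  set (e := exp x) in *. set (y := PSeries _ x) in *.
  assert (H' : y * (e * e + 1) = e * e - 1).
  { replace (y * (e * e + 1)) with (2 * e * (y * ((e + / e) / 2))) by (field; lra).
    rewrite H. field; lra. }
  assert (0 < e * e) by now apply Rmult_lt_0_compat.
  apply (Rmult_eq_reg_r (e * e + 1)); [|lra].
  unfold Rdiv. rewrite Rmult_assoc, Rinv_l, Rmult_plus_distr_r by lra. lra.
Qed.

(** Convergence at all points of an open disk gives the strict radius condition
    under which products and uniqueness of power series are available: each
    point of the disk is exceeded by another one. *)
Lemma CV_radius_gt_of_disk (a : nat -> R) r t :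
  (forall s, Rabs s < r -> ex_pseries a s) -> Rabs t < r ->
  Rbar_lt (Rabs t) (CV_radius a).
Proof.
intros Ha Ht. pose proof (Rabs_pos t) as H0.
set (s := (Rabs t + r) / 2).
assert (Hs : Rabs s = s) by (apply Rabs_pos_eq; unfold s; lra).
apply Rbar_lt_le_trans with s; [simpl; unfold s; lra|].
rewrite <- Hs.
apply Rbar_not_lt_le. intros Hlt. apply (CV_disk_outside a s Hlt).
apply ex_series_lim_0, ex_pseries_R, Ha.
rewrite Hs; unfold s; lra.
Qed.

Lemma exp_series x t :
  is_pseries (fun n => x ^ n / INR (fact n)) t (exp (x * t)).
Proof.
apply is_pseries_R.
apply is_series_ext with (fun n => / INR (fact n) * (x * t) ^ n).
{ intros n. rewrite Rpow_mult_distr, <- Rmult_assoc. f_equal. apply Rmult_comm. }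
apply is_pseries_R, is_exp_Reals.
Qed.

(** Any expansion converging on the whole interval licenses the use of the
    sequence chosen by [egf_coef], which then satisfies the same expansion. *)
Lemma egf_coef_spec r F (a : nat -> R) :
  (forall t, Rabs t < r -> is_pseries a t (F t)) -> egf_on r F (egf_coef r F).
Proof.
intros Ha. unfold egf_coef. apply epsilon_spec.
exists (fun n => a n * INR (fact n)). intros t Ht.
apply is_pseries_ext with a; [|now apply Ha].
intros n. change (a n = a n * INR (fact n) / INR (fact n)).
field. apply INR_fact_neq_0.
Qed.

Lemma genocchi_radius_1 b : genocchi_radius 1 b = PI / Rabs (ln b).
Proof.
unfold genocchi_radius. rewrite ln_1, <- Rabs_Ropp. do 2 f_equal. ring.
Qed.

Lemma Rpower_1_base t : Rpower 1 t = 1.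
Proof. unfold Rpower. now rewrite ln_1, Rmult_0_r, exp_0. Qed.

Lemma genocchi_kernel_series b : ln b <> 0 ->
  exists a, forall t, Rabs t < genocchi_radius 1 b ->
    is_pseries a t (2 * t / (Rpower b t + Rpower 1 t)).
Proof.
intros HL. destruct (logistic_series (ln b) HL) as [a Ha].
exists (PS_incr_1 a). intros t Ht.
replace (2 * t / (Rpower b t + Rpower 1 t)) with (t * (2 / (exp (ln b * t) + 1))).
- apply (is_pseries_incr_1 a t (2 / (exp (ln b * t) + 1))), Ha.
  now rewrite <- genocchi_radius_1.
- rewrite Rpower_1_base. unfold Rpower. rewrite (Rmult_comm (ln b) t).
  unfold Rdiv. ring.
Qed.

Lemma genocchi_num_spec b : ln b <> 0 ->
  egf_on (genocchi_radius 1 b)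
    (fun t => 2 * t / (Rpower b t + Rpower 1 t)) (genocchi_num 1 b).
Proof.
intros HL. destruct (genocchi_kernel_series b HL) as [a Ha].
exact (egf_coef_spec _ _ a Ha).
Qed.

Lemma genocchi_poly_spec x b c : ln b <> 0 ->
  egf_on (genocchi_radius 1 b)
    (fun t => 2 * t / (Rpower b t + Rpower 1 t) * Rpower c (x * t))
    (genocchi_poly x 1 b c).
Proof.
intros HL. destruct (genocchi_kernel_series b HL) as [a Ha].
apply egf_coef_spec with
  (PS_mult a (fun n => (x * ln c) ^ n / INR (fact n))).
intros t Ht.
assert (He : forall s, is_pseries (fun n => (x * ln c) ^ n / INR (fact n)) s
                         (Rpower c (x * s))).
{ intros s. unfold Rpower. replace (x * s * ln c) with (x * ln c * s) by ring.
  apply exp_series. }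
apply is_pseries_mult; auto.
- apply CV_radius_gt_of_disk with (2 := Ht).
  intros s Hs. eexists. now apply Ha.
- apply CV_radius_gt_of_disk with (2 := Ht).
  intros s Hs. eexists. apply He.
Qed.

(** * The alternating sum *)

Lemma alternating_geometric q m :
  (1 + q) * sum_f_R0 (fun k => (-1) ^ k * q ^ k) m = 1 - (-1) ^ S m * q ^ S m.
Proof.
induction m as [|m IH]; [simpl; ring|].
rewrite tech5, Rmult_plus_distr_l, IH. simpl. ring.
Qed.

Lemma is_pseries_sum_f_R0 (c : nat -> R) (a : nat -> nat -> R) (F : nat -> R) t m :
  (forall k, is_pseries (a k) t (F k)) ->
  is_pseries (fun n => sum_f_R0 (fun k => c k * a k n) m) t
    (sum_f_R0 (fun k => c k * F k) m).
Proof.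
intros Ha.
assert (Hk : forall k, is_pseries (fun n => c k * a k n) t (c k * F k)).
{ intros k. apply (is_pseries_scal (c k) (a k) t (F k)); [apply Rmult_comm|apply Ha]. }
induction m as [|m IH]; [apply Hk|].
exact (is_pseries_plus _ _ t _ _ IH (Hk (S m))).
Qed.

(** The identity theorem for power series, for expansions of one function on a
    common interval. *)
Lemma is_pseries_coef_unique (a a' : nat -> R) (F : R -> R) r n : 0 < r ->
  (forall t, Rabs t < r -> is_pseries a t (F t)) ->
  (forall t, Rabs t < r -> is_pseries a' t (F t)) ->
  a n = a' n.
Proof.
intros Hr Ha Ha'.
assert (H0 : Rabs 0 < r) by now rewrite Rabs_R0.
apply PSeries_ext_recip.
- rewrite <- Rabs_R0. apply CV_radius_gt_of_disk with (2 := H0).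
  intros s Hs. eexists. now apply Ha.
- rewrite <- Rabs_R0. apply CV_radius_gt_of_disk with (2 := H0).
  intros s Hs. eexists. now apply Ha'.
- exists (mkposreal r Hr). intros t Ht.
  assert (Hrt : Rabs t < r).
  { rewrite <- (Rminus_0_r t). exact Ht. }
  now rewrite (is_pseries_unique _ _ _ (Ha t Hrt)),
    (is_pseries_unique _ _ _ (Ha' t Hrt)).
Qed.

Theorem theorem11 (m n : nat) (b : R)
  (hm : (0 < m)%nat) (hn : (0 < n)%nat) (hb : 0 < b) (hb1 : b <> 1) :
  sum_f_R0 (fun k => (-1) ^ k * INR k ^ n) (m - 1) =
  (genocchi_num 1 b (n + 1) - (-1) ^ m * genocchi_poly (INR m) 1 b b (n + 1))
    / (2 * (INR n + 1) * ln b ^ n).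
Proof.
assert (HL : ln b <> 0) by (apply ln_neq_0; auto).
assert (Hr : 0 < genocchi_radius 1 b).
{ rewrite genocchi_radius_1. apply Rdiv_lt_0_compat;
    [apply PI_RGT_0|now apply Rabs_pos_lt]. }
set (G := genocchi_num 1 b). set (P := genocchi_poly (INR m) 1 b b).
(* Taylor coefficients of the sum of (-1)^k b^(k t) over k < m. *)
set (A := fun p => sum_f_R0 (fun k => (-1) ^ k * ((INR k * ln b) ^ p / INR (fact p)))
                     (m - 1)).
(* Both sides are the coefficient of t^(n+1) in the same function, written
   once as a combination of generating functions, once as a geometric sum. *)
assert (Hcoef : (G (S n) - (-1) ^ m * P (S n)) / INR (fact (S n)) = 2 * A n).
{ apply (is_pseries_coef_unique
    (fun p => (G p - (-1) ^ m * P p) / INR (fact p))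
    (PS_incr_1 (PS_scal 2 A))
    (fun t => 2 * t / (Rpower b t + Rpower 1 t)
              - (-1) ^ m * (2 * t / (Rpower b t + Rpower 1 t) * Rpower b (INR m * t)))
    (genocchi_radius 1 b) (S n) Hr).
  - intros t Ht.
    apply is_pseries_ext with
      (PS_minus (fun p => G p / INR (fact p))
         (PS_scal ((-1) ^ m) (fun p => P p / INR (fact p)))).
    { intros p. unfold PS_minus, PS_plus, PS_opp, PS_scal.
      unfold plus, opp, scal; simpl; unfold mult; simpl. field.
      apply INR_fact_neq_0. }
    apply (is_pseries_minus _ _ t (2 * t / (Rpower b t + Rpower 1 t))
             ((-1) ^ m * _)).
    + now apply genocchi_num_spec.
    + apply (is_pseries_scal ((-1) ^ m) (fun p => P p / INR (fact p)) t
        (2 * t / (Rpower b t + Rpower 1 t) * Rpower b (INR m * t)));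
        [apply Rmult_comm|].
      now apply genocchi_poly_spec.
  - intros t Ht.
    set (q := Rpower b t).
    assert (Hpow : forall k, Rpower b (INR k * t) = q ^ k).
    { intros k. unfold q. rewrite Rmult_comm, <- Rpower_mult.
      apply Rpower_pow, exp_pos. }
    replace (_ - _) with
      (t * (2 * sum_f_R0 (fun k => (-1) ^ k * exp (INR k * ln b * t)) (m - 1))).
    + apply (is_pseries_incr_1 (PS_scal 2 A) t
        (2 * sum_f_R0 (fun k => (-1) ^ k * exp (INR k * ln b * t)) (m - 1))).
      apply (is_pseries_scal 2 A t
        (sum_f_R0 (fun k => (-1) ^ k * exp (INR k * ln b * t)) (m - 1)));
        [apply Rmult_comm|].
      apply is_pseries_sum_f_R0. intros k. apply exp_series.
    + rewrite (sum_eq _ (fun k => (-1) ^ k * q ^ k)).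
      2:{ intros k _. rewrite <- Hpow. unfold Rpower. do 2 f_equal. ring. }
      rewrite Rpower_1_base, Hpow.
      assert (Hq : 0 < q) by apply exp_pos.
      pose proof (alternating_geometric q (m - 1)) as Hg.
      replace (S (m - 1)) with m in Hg by lia.
      apply (Rmult_eq_reg_l (1 + q)); [|lra].
      transitivity (2 * t * ((1 + q) * sum_f_R0 (fun k => (-1) ^ k * q ^ k) (m - 1)));
        [ring|].
      rewrite Hg. field. lra. }
assert (HA : A n = ln b ^ n / INR (fact n)
               * sum_f_R0 (fun k => (-1) ^ k * INR k ^ n) (m - 1)).
{ unfold A. rewrite scal_sum. apply sum_eq. intros k _.
  rewrite Rpow_mult_distr. unfold Rdiv. ring. }
rewrite HA, fact_simpl, mult_INR, S_INR in Hcoef.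
rewrite Nat.add_1_r.
pose proof (INR_fact_neq_0 n). pose proof (pos_INR n).
assert (ln b ^ n <> 0) by now apply pow_nonzero.
(* [Hcoef] gives X / (n+1)!; the factorial is restored to use it. *)
set (X := G (S n) - (-1) ^ m * P (S n)) in *.
replace X with (X / ((INR n + 1) * INR (fact n)) * ((INR n + 1) * INR (fact n)))
  by (field; lra).
rewrite Hcoef. field. lra.
Qed.
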